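(* Let $a\leqslant b$ be two positive integers, and let $G$ be a (finite, simple) graph of order $n$, where $n\geqslant a+1$, and where $na\equiv 0\pmod{2}$ in the case $a=b$. If $G$ contains no $[a,b]$-factor, then $$e(G)\leqslant \binom{n-1}{2}+a-1,$$ with equality if and only if one of the following holds: (i) $G\cong K_{a-1}\vee (K_{n-a}\cup K_1)$ or $G\cong K_{1,3}$, if $ab=1$ or $ab=2$; (ii) $G\cong K_{a-1}\vee (K_{n-a}\cup K_1)$ or $G\cong K_2\vee \overline{K_3}$, if $a=b=2$; (iii) $G\cong K_{a-1}\vee (K_{n-a}\cup K_1)$, if $b\geqslant 3$.
   Context: For positive integers $a\leqslant b$, an $[a,b]$-factor of a graph $G$ is a spanning subgraph $F$ of $G$ such that $a\leqslant d_F(v)\leqslant b$ for all $v\in V(G)$. $e(G)$ denotes the number of edges. $G\cup H$ is the disjoint union; $G\vee H$ is the join (disjoint union plus all edges between $G$ and $H$); $K_0\vee H=H$. $\overline{K_3}$ is the empty graph on 3 vertices. *)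

(* Defs.v *)
From mathcomp Require Import all_boot.

Set Implicit Arguments.
Unset Strict Implicit.
Unset Printing Implicit Defensive.

Record sgraph (T : finType) := SGraph {
  adj :> rel T;
  adj_sym : symmetric adj;
  adj_irr : irreflexive adj }.

Definition edges (T : finType) (G : sgraph T) : {set {set T}} :=
  [set [set x; y] | x in T, y in T & G x y].

Definition degree (T : finType) (G : sgraph T) (x : T) : nat :=
  #|[set y | G x y]|.

(* A spanning subgraph of G : sgraph T is an F : sgraph T on the same vertex
   type T whose adjacency implies that of G. *)
Definition spanning_subgraph (T : finType) (F G : sgraph T) : Prop :=
  forall x y, F x y -> G x y.

Definition is_factor (a b : nat) (T : finType) (F G : sgraph T) : Prop :=
  spanning_subgraph F G /\ forall v, a <= degree F v <= b.

Definition isomorphic (T U : finType) (G : sgraph T) (H : sgraph U) : Prop :=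
  exists2 f : T -> U, bijective f & forall x y, H (f x) (f y) = G x y.

Lemma neq_sym (T : finType) : symmetric (fun x y : T => x != y).
Proof. by move=> x y; rewrite eq_sym. Qed.

Lemma neq_irr (T : finType) : irreflexive (fun x y : T => x != y).
Proof. by move=> x; rewrite eqxx. Qed.

Definition complete (n : nat) : sgraph 'I_n :=
  SGraph (@neq_sym 'I_n) (@neq_irr 'I_n).

Definition edgeless (n : nat) : sgraph 'I_n :=
  @SGraph 'I_n (fun _ _ => false) (fun _ _ => erefl) (fun _ => erefl).

(* The disjoint union (cross = false) and the join (cross = true) differ only
   in the adjacency between the two summands. *)
Definition sum_adj (cross : bool) (T U : finType) (G : sgraph T)
    (H : sgraph U) : rel (T + U)%type :=
  fun p q => match p, q with
  | inl x, inl y => G x y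
  | inr x, inr y => H x y
  | _, _ => cross
  end.

Lemma sum_adj_sym cross (T U : finType) (G : sgraph T) (H : sgraph U) :
  symmetric (sum_adj cross G H).
Proof. by move=> [x|x] [y|y] //=; apply: adj_sym. Qed.

Lemma sum_adj_irr cross (T U : finType) (G : sgraph T) (H : sgraph U) :
  irreflexive (sum_adj cross G H).
Proof. by move=> [x|x] /=; apply: adj_irr. Qed.

Definition disjoint_union (T U : finType) (G : sgraph T) (H : sgraph U) :
    sgraph (T + U)%type :=
  SGraph (@sum_adj_sym false T U G H) (@sum_adj_irr false T U G H).

Definition join (T U : finType) (G : sgraph T) (H : sgraph U) :
    sgraph (T + U)%type :=
  SGraph (@sum_adj_sym true T U G H) (@sum_adj_irr true T U G H).

Definition complete_bipartite (m n : nat) : sgraph ('I_m + 'I_n)%type :=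
  join (edgeless m) (edgeless n).

(* K_{a-1} \/ (K_{n-a} U K_1) *)
Definition extremal_graph (n a : nat) :
    sgraph ('I_(a - 1) + ('I_(n - a) + 'I_1))%type :=
  join (complete (a - 1)) (disjoint_union (complete (n - a)) (complete 1)).

(* Main.v *)
Require Import Defs.
From mathcomp Require Import all_boot.
From mathcomp Require Import zify.
From Stdlib Require Import Classical_Prop.

Set Implicit Arguments.
Unset Strict Implicit.
Unset Printing Implicit Defensive.

(** Let H be the complement of G, let h(v) be the degree of v in H and
N = n - a. The bound says that H has at least N edges, so assume that it has at
most N. If h(x) >= N for some x, then H is a star with N edges, that is, G is
the extremal graph. Otherwise G has a spanning subgraph of degree a except for
at most one vertex of degree a + 1, unless H is a triangle and n = a + 3 with
a = 1 or a = 2; parity excludes the exceptional vertex when a = b.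

To find the subgraph, consider graphs E with L <= E <= M and degrees at most c,
having as many edges as possible, where either L is empty, M = G, c = a (when
a = 1 or N >= a + 2), or L = H, M = K_n, c = N - 1 and the complement of E is
wanted (when N <= a + 1). If two units of degree are missing, at x and y, then
the edges of E between P = N_{M-E}(x) and Q = N_{M-E}(y) all lie in L, and
double counting shows that there are at least c(|P| + |Q| + 2 - n) of them. In
the second setting this exceeds the degree sum of H except for the triangle. In
the first one it gives h(x) + h(y) >= N - a + 2, and the deficiency at x can be
moved along E to any neighbour of P. Choosing the pair (x, y) with h(y) minimal
and summing h over all vertices reached in this way forces h(y) = 2, N = a + 2
and H two-regular on N vertices; for a >= 2 the equality case of the count then
forces xy to be an edge of E, while the deficiency can be moved to an
H-neighbour of y. *)

(** * Indicator sums and extremal choice *)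

Lemma eq_sum_pointwise (I : finType) (f g : I -> nat) :
  (forall i, f i <= g i) -> \sum_i g i <= \sum_i f i -> forall i, f i = g i.
Proof.
move=> le_fg le_sum i; apply/eqP; rewrite eqn_leq le_fg /=.
move: le_sum; rewrite (bigD1 i) //= [X in _ <= X](bigD1 i) //=.
have : \sum_(j | j != i) f j <= \sum_(j | j != i) g j by apply: leq_sum.
lia.
Qed.

Lemma sum_mem_const (I : finType) (A : {set I}) (c : nat) :
  \sum_i c * (i \in A) = c * #|A|.
Proof. by rewrite -big_distrr /= -sum1_card [in RHS]big_mkcond. Qed.

Lemma sum_eq_const (I : finType) (j : I) (F : I -> nat) :
  \sum_i (i == j) * F i = F j.
Proof.
rewrite (bigD1 j) //= eqxx mul1n big1 ?addn0 // => i /negbTE ->; by rewrite mul0n.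
Qed.

Lemma sum_eq1 (I : finType) (j : I) : \sum_i (i == j) = 1.
Proof.
by rewrite -[RHS](sum_eq_const j (fun=> 1)); apply: eq_bigr => i _; rewrite muln1.
Qed.

Lemma ex_max_measure (X : Type) (P : X -> Prop) (mu : X -> nat) (B : nat) :
  (forall x, P x -> mu x <= B) -> (exists x, P x) ->
  exists2 x, P x & forall y, P y -> mu y <= mu x.
Proof.
move=> le_B [x Px].
have [d] := ubnP (B - mu x); elim: d x Px => // d IH x Px lt_d.
have [[y Py lt_xy]|no_y] := classic (exists2 y, P y & mu x < mu y).
  by apply: (IH y Py); have := le_B y Py; lia.
exists x => // y Py; rewrite leqNgt; apply/negP => lt_xy.
by apply: no_y; exists y.
Qed.

Lemma ex_min_measure (X : Type) (P : X -> Prop) (mu : X -> nat) :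
  (exists x, P x) -> exists2 x, P x & forall y, P y -> mu x <= mu y.
Proof.
case=> x Px; have [d] := ubnP (mu x); elim: d x Px => // d IH x Px lt_d.
have [[y Py lt_yx]|no_y] := classic (exists2 y, P y & mu y < mu x).
  by apply: (IH y Py); lia.
exists x => // y Py; rewrite leqNgt; apply/negP => lt_yx.
by apply: no_y; exists y.
Qed.

(** * Complements, changes of one edge, and the handshake identity *)

Section Graphs.
Variable T : finType.
Implicit Types (G E : sgraph T) (x y u v w : T).

Lemma degreeE G x : degree G x = \sum_y G x y.
Proof. by rewrite /degree -sum1_card big_mkcond; apply: eq_bigr => y _; rewrite inE; case: (G x y). Qed.

Lemma eq_degree G E : (forall x y, G x y = E x y) -> degree G =1 degree E.
Proof. by move=> eqGE x; rewrite !degreeE; apply: eq_bigr => y _; rewrite eqGE. Qed.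

Lemma degree_gt0P G x : reflect (exists y, G x y) (0 < degree G x).
Proof.
apply: (iffP card_gt0P) => -[y]; first by rewrite inE; exists y.
by exists y; rewrite inE.
Qed.

Lemma adj_neq G x y : G x y -> x != y.
Proof. by apply: contraTneq => ->; rewrite adj_irr. Qed.

Definition compl_adj G : rel T := fun x y => (x != y) && ~~ G x y.

Lemma compl_adj_sym G : symmetric (compl_adj G).
Proof. by move=> x y; rewrite /compl_adj eq_sym adj_sym. Qed.

Lemma compl_adj_irr G : irreflexive (compl_adj G).
Proof. by move=> x; rewrite /compl_adj eqxx. Qed.

Definition compl G : sgraph T := SGraph (compl_adj_sym G) (compl_adj_irr G).

Definition empty_graph : sgraph T :=
  @SGraph T (fun _ _ => false) (fun _ _ => erefl) (fun _ => erefl).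

Lemma degree_compl G x : degree G x + degree (compl G) x + 1 = #|T|.
Proof.
rewrite !degreeE -(sum_eq_const x (fun=> 1)) -!big_split /= -sum1_card.
apply: eq_bigr => y _; rewrite /compl_adj eq_sym.
by have [->|_] := eqVneq x y; rewrite ?adj_irr //; case: (G x y).
Qed.

(** The guard [u != v] keeps the relation irreflexive even for [x = y]. *)
Definition add_adj G x y : rel T := fun u v =>
  (u != v) && [|| G u v, (u == x) && (v == y) | (u == y) && (v == x)].

Lemma add_adj_sym G x y : symmetric (add_adj G x y).
Proof.
move=> u v; rewrite /add_adj eq_sym adj_sym; congr (_ && (_ || _)).
by rewrite orbC; congr (_ || _); rewrite andbC.
Qed.

Lemma add_adj_irr G x y : irreflexive (add_adj G x y).
Proof. by move=> u; rewrite /add_adj eqxx. Qed.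

Definition add_edge G x y := SGraph (add_adj_sym G x y) (add_adj_irr G x y).

Definition del_adj G x y : rel T := fun u v =>
  G u v && ~~ ((u == x) && (v == y) || (u == y) && (v == x)).

Lemma del_adj_sym G x y : symmetric (del_adj G x y).
Proof.
move=> u v; rewrite /del_adj adj_sym; congr (_ && ~~ _).
by rewrite orbC; congr (_ || _); rewrite andbC.
Qed.

Lemma del_adj_irr G x y : irreflexive (del_adj G x y).
Proof. by move=> u; rewrite /del_adj adj_irr. Qed.

Definition del_edge G x y := SGraph (del_adj_sym G x y) (del_adj_irr G x y).

Lemma add_edgeP G x y u v : add_edge G x y u v ->
  [\/ G u v, u = x /\ v = y | u = y /\ v = x].
Proof.
case/andP=> _ /or3P[->|/andP[/eqP -> /eqP ->]|/andP[/eqP -> /eqP ->]];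
  by [constructor 1 | constructor 2 | constructor 3].
Qed.

Lemma add_edge_sub G x y u v : G u v -> add_edge G x y u v.
Proof. by move=> Guv; rewrite /= /add_adj Guv (adj_neq Guv). Qed.

Lemma degree_add G x y w : x != y -> ~~ G x y ->
  degree (add_edge G x y) w = degree G w + (w == x) + (w == y).
Proof.
move=> neq_xy nGxy; rewrite !degreeE.
have -> : nat_of_bool (w == x) = \sum_v (v == y) * (w == x)
  by rewrite sum_eq_const.
have -> : nat_of_bool (w == y) = \sum_v (v == x) * (w == y)
  by rewrite sum_eq_const.
rewrite -!big_split /=; apply: eq_bigr => v _; rewrite /add_adj.
have [->|nwx] := eqVneq w x; have [->|nvy] := eqVneq v y.
- by rewrite (negbTE neq_xy) (negbTE nGxy) eq_sym (negbTE neq_xy).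
- rewrite (negbTE neq_xy) ?muln0 /= ?orbF ?addn0.
  by case Gxv: (G x v); rewrite ?andbF // (adj_neq Gxv).
- have [->|nwy] := eqVneq w y; first by rewrite adj_irr [y == x]eq_sym (negbTE neq_xy).
  by rewrite /= ?orbF ?muln0 ?addn0; case: (G w y).
- have [->|nwy] := eqVneq w y; have [->|nvx] := eqVneq v x => /=.
  + by rewrite eq_sym neq_xy adj_sym (negbTE nGxy).
  + rewrite ?orbF ?addn0; case Gyv: (G y v); rewrite ?andbF //.
    by rewrite (adj_neq Gyv).
  + by rewrite ?orbF ?addn0; case Gwv: (G w x); rewrite ?andbF // (adj_neq Gwv).
  + by rewrite ?orbF ?addn0; case Gwv: (G w v); rewrite ?andbF // (adj_neq Gwv).
Qed.

Lemma degree_del G x y w : G x y ->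
  degree G w = degree (del_edge G x y) w + (w == x) + (w == y).
Proof.
move=> Gxy; rewrite -degree_add ?(adj_neq Gxy) //; last first.
  by rewrite /= /del_adj !eqxx /= andbF.
apply: eq_degree => u v /=; rewrite /add_adj /= /del_adj.
have [Euv|] := boolP ((u == x) && (v == y) || (u == y) && (v == x)).
  rewrite orbT andbT; case/orP: Euv => /andP[/eqP -> /eqP ->].
    by rewrite Gxy (adj_neq Gxy).
  by rewrite adj_sym Gxy eq_sym (adj_neq Gxy).
by rewrite andbT orbF; case Guv: (G u v); rewrite ?andbF // (adj_neq Guv).
Qed.

Lemma sum_degree G : \sum_x degree G x = 2 * #|edges G|.
Proof.
(* Ordered adjacent pairs map onto the edges, with fibres of exactly two elements. *)
pose D := [set p : T * T | G p.1 p.2].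
have -> : edges G = (fun p : T * T => [set p.1; p.2]) @: D.
  apply/setP => e; apply/imset2P/imsetP => [[x y _]|[[x y]]].
    by rewrite inE => /andP[_ Gxy] ->; exists (x, y); rewrite ?inE.
  by rewrite inE /= => Gxy ->; exists x y; rewrite ?inE.
transitivity #|D|.
  under eq_bigr do rewrite degreeE.
  rewrite pair_big /= -sum1_card [RHS]big_mkcond.
  by apply: eq_bigr => p _; rewrite inE; case: (G _ _).
rewrite -sum1_card (partition_big_imset (fun p : T * T => [set p.1; p.2])) /=.
rewrite mulnC -sum_nat_const; apply: eq_bigr => e /imsetP[[x y]].
rewrite inE /= => Gxy ->; rewrite sum1dep_card.
have neq_xy := adj_neq Gxy.
rewrite (_ : [set _ | _] = [set (x, y); (y, x)]).
  by rewrite cards2 xpair_eqE negb_and neq_xy.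
apply/setP => -[u v]; rewrite !inE /= !xpair_eqE.
apply/andP/orP => [[Guv /eqP/setP eq_uv]|].
  have := adj_neq Guv; have := eq_uv u; have := eq_uv v; rewrite !inE !eqxx orbT.
  by move=> /esym/orP[] /eqP -> /esym/orP[] /eqP ->; rewrite !eqxx //;
    [right | left].
case=> /andP[/eqP -> /eqP ->]; first by rewrite Gxy.
by rewrite adj_sym Gxy setUC.
Qed.

End Graphs.

(** * Alternating exchanges *)

Section Exchange.
Variables (T : finType) (L M : sgraph T) (c : nat).
Implicit Types (E : sgraph T) (x y u v w : T).

Definition admissible E : Prop :=
  [/\ forall u v, L u v -> E u v, forall u v, E u v -> M u v
    & forall w, degree E w <= c].

(** The degree sum stands for twice the number of edges. *)
Definition optimal E : Prop := admissible E /\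
  forall E', admissible E' -> \sum_w degree E' w <= \sum_w degree E w.

(** For [x = y] both indicators count at the same vertex, so two units must be missing there. *)
Definition raisable E x y : Prop :=
  forall w, degree E w + (w == x) + (w == y) <= c.

Definition free_nbrs E x : {set T} := [set u | M x u && ~~ E x u].

Lemma ex_optimal : (forall u v, L u v -> M u v) -> (forall w, degree L w <= c) ->
  exists E, optimal E.
Proof.
move=> sLM degL.
have [E admE maxE] : exists2 E, admissible E &
    forall E', admissible E' -> \sum_w degree E' w <= \sum_w degree E w.
  apply: (@ex_max_measure _ _ _ (\sum_(w : T) c)); last by exists L.
  by move=> E [_ _ degE]; apply: leq_sum.
by exists E.
Qed.

Lemma raisable_sym E x y : raisable E x y -> raisable E y x.
Proof. by move=> r w; have := r w; lia. Qed.

Lemma raisable_lt E x y : raisable E x y -> degree E x < c.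
Proof. by move=> r; have := r x; rewrite eqxx; lia. Qed.

(** A second missing unit, at the same vertex or at another one, would give a raisable pair. *)
Lemma near_regular E : admissible E -> (forall x y, ~ raisable E x y) ->
  (forall w, degree E w = c) \/
  exists2 x, (degree E x).+1 = c & forall w, w != x -> degree E w = c.
Proof.
move=> [_ _ degE] nr.
have [/forallP Ec|/forallPn[x nEx]] := boolP [forall w, degree E w == c].
  by left=> w; apply/eqP.
right; have lt_x : degree E x < c by rewrite ltn_neqAle nEx degE.
exists x.
  apply/eqP; rewrite eqn_leq lt_x leqNgt; apply/negP => lt2.
  by apply: (nr x x) => w; have := degE w; have [->|] := eqVneq w x; lia.
move=> w nwx; apply/eqP; rewrite eqn_leq degE leqNgt; apply/negP => lt_w.
apply: (nr x w) => u; have := degE u; have [->|nux] := eqVneq u x.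
  by rewrite eq_sym (negbTE nwx); lia.
by have [->|] := eqVneq u w; lia.
Qed.

Lemma free_nbrs_sym E x u : (u \in free_nbrs E x) = (x \in free_nbrs E u).
Proof. by rewrite !inE ![_ x u]adj_sym. Qed.

(** Otherwise the edge [xy] could be added, raising the degree sum by two. *)
Lemma raisable_not_free E x y : optimal E -> raisable E x y -> y \notin free_nbrs E x.
Proof.
move=> optE r; rewrite inE; apply/negP => /andP[Mxy nExy].
have [[sLE sEM degE] maxE] := optE; have nxy := adj_neq Mxy.
have /maxE : admissible (add_edge E x y).
  split=> [u v /sLE Euv|u v /add_edgeP[/sEM //|[-> ->] //|[-> ->]]|w].
  - exact: add_edge_sub.
  - by rewrite adj_sym.
  - by rewrite degree_add.
under eq_bigr do rewrite degree_add //.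
rewrite !big_split /=.
by rewrite !sum_eq1; lia.
Qed.

Lemma free_nbr_saturated E x u : optimal E ->
  degree E x < c -> u \in free_nbrs E x -> degree E u = c.
Proof.
move=> optE lt_x Fxu; have [[_ _ degE] _] := optE.
apply/eqP; rewrite eqn_leq degE leqNgt; apply/negP => lt_u.
have nxu : x != u by move: Fxu; rewrite inE => /andP[/adj_neq].
suff /(raisable_not_free optE) : raisable E x u by rewrite Fxu.
move=> w; have := degE w; have [->|_] := eqVneq w x.
  by rewrite (negbTE nxu); lia.
by have [->|] := eqVneq w u; lia.
Qed.

(* The alternating path x - u - v: deficiency moves from x to v. *)
Definition shift_edge E x u v := add_edge (del_edge E u v) x u.

Lemma degree_shift E x u v w : u \in free_nbrs E x -> E u v ->
  degree (shift_edge E x u v) w + (w == v) = degree E w + (w == x).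
Proof.
rewrite inE => /andP[Mxu nExu] Euv.
rewrite degree_add ?(adj_neq Mxu) //= /del_adj ?(negbTE nExu) //.
by rewrite (degree_del w Euv); lia.
Qed.

Lemma shift_admissible E x y u v : optimal E -> raisable E x y ->
  u \in free_nbrs E x -> E u v -> ~~ L u v -> admissible (shift_edge E x u v).
Proof.
move=> optE r Fxu Euv nLuv; have [[sLE sEM degE] _] := optE.
have := Fxu; rewrite inE => /andP[Mxu nExu].
split=> [p q Lpq|p q|w].
- apply: add_edge_sub; rewrite /= /del_adj (sLE _ _ Lpq) /=.
  by apply: contra nLuv => /orP[] /andP[/eqP <- /eqP <-] //; rewrite adj_sym.
- by case/add_edgeP => [/andP[/sEM]|[-> ->]|[-> ->]] //; rewrite adj_sym.
- have := degree_shift w Fxu Euv; have := r w; lia.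
Qed.

Lemma shift_optimal E x y u v : optimal E -> raisable E x y ->
  u \in free_nbrs E x -> E u v -> ~~ L u v -> optimal (shift_edge E x u v).
Proof.
move=> optE r Fxu Euv nLuv; split; first exact: shift_admissible r _ _ _.
move=> E' /(proj2 optE); rewrite -(leq_add2r 1).
have -> : \sum_w degree E w + 1 = \sum_w degree (shift_edge E x u v) w + 1.
  rewrite -[1 in LHS](sum_eq1 x) -[1 in RHS](sum_eq1 v) -!big_split.
  by apply: eq_bigr => w _; rewrite /= degree_shift.
by rewrite leq_add2r.
Qed.

Lemma shift_raisable E x y u v : raisable E x y ->
  u \in free_nbrs E x -> E u v -> raisable (shift_edge E x u v) v y.
Proof.
by move=> r Fxu Euv w; have := degree_shift w Fxu Euv; have := r w; lia.
Qed.

(** If [uv] were outside [L], shifting along x - u - v would make [v] and [y] a raisable pair while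
    [yv] is still free, against optimality. *)
Lemma free_free_adj E x y u v : optimal E -> raisable E x y ->
  u \in free_nbrs E x -> v \in free_nbrs E y -> E u v -> L u v.
Proof.
move=> optE r Fxu Fyv Euv; apply: contraT => nLuv.
have := raisable_not_free (shift_optimal optE r Fxu Euv nLuv)
  (raisable_sym (shift_raisable r Fxu Euv)).
move: Fyv; rewrite !inE negb_and negbK => /andP[-> nEyv] /=.
case/add_edgeP => [/andP[Eyv _]|[_ Ev]|[Ey _]]; first by rewrite Eyv in nEyv.
  by move: Euv; rewrite Ev adj_irr.
by move: (raisable_not_free optE r); rewrite Ey Fxu.
Qed.
End Exchange.

(** * Double counting *)

Section Counting.
Variables (T : finType) (L M : sgraph T) (c : nat) (E : sgraph T).
Hypothesis optE : optimal L M c E.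
Implicit Types (x y u v w : T) (A : {set T}).

Definition nbrs_in A v := \sum_(u in A) E u v.

Lemma sum_degree_in A : \sum_(u in A) degree E u = \sum_v nbrs_in A v.
Proof. by under eq_bigr do rewrite degreeE; rewrite exchange_big. Qed.

Lemma nbrs_in_out A v y : y \notin A -> nbrs_in A v + E v y <= degree E v.
Proof.
move=> nAy; rewrite degreeE (bigID (mem A)) /= leq_add //.
  by apply: leq_sum => u _; rewrite adj_sym.
by rewrite (bigD1 y) //= leq_addr.
Qed.

Lemma nbrs_in_sub A v : nbrs_in A v <= degree E v.
Proof.
rewrite degreeE (bigID (mem A)) /=; apply: leq_trans (leq_addr _ _).
by apply: leq_sum => u _; rewrite adj_sym.
Qed.

Lemma free_nbrs_irr x : x \notin free_nbrs M E x.
Proof. by rewrite inE adj_irr. Qed.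

Lemma nbrs_in_free x : nbrs_in (free_nbrs M E x) x = 0.
Proof.
apply: big1 => u; rewrite inE => /andP[_ /negbTE nE].
by rewrite adj_sym nE.
Qed.

Lemma sum_degree_free x : degree E x < c ->
  \sum_v nbrs_in (free_nbrs M E x) v = c * #|free_nbrs M E x|.
Proof.
move=> lt_x; rewrite -sum_degree_in mulnC -sum_nat_const.
by apply: eq_bigr => u /(free_nbr_saturated optE lt_x).
Qed.

Definition cross x y :=
  \sum_(v in free_nbrs M E y) nbrs_in (free_nbrs M E x) v.

(* Termwise form of the double count of the edges leaving [free_nbrs M E x]:
   the terms [E y v], [(v == y) * degree E y] and [E x y] cancel after summation. *)
Definition count_lhs x y v :=
  nbrs_in (free_nbrs M E x) v * (v \notin free_nbrs M E y) + E y v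
  + c * (v \in free_nbrs M E y) + c * (v == x) + c * (v == y) + (v == y) * E x y.

Definition count_rhs x y v := c + (v == y) * degree E y + (v == x) * E y x.

Lemma sum_nbrs_outside x y : degree E x < c ->
  \sum_v nbrs_in (free_nbrs M E x) v * (v \notin free_nbrs M E y) + cross x y
  = c * #|free_nbrs M E x|.
Proof.
move=> lt_x; rewrite -sum_degree_free // /cross [X in _ + X]big_mkcond -big_split /=.
by apply: eq_bigr => v _; case: (v \in _); rewrite ?muln0 ?muln1 ?addn0.
Qed.

(** Since [y] is not free for [x], the edges from [v] to [free_nbrs M E x] and to [y] are distinct,
    so there are at most [c]. If [v] is free for [y], then [E y v] vanishes and [c] replaces them.
    At [x] and [y] the correction terms balance. *)
Lemma count_pointwise x y : raisable c E x y -> x != y ->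
  forall v, count_lhs x y v <= count_rhs x y v.
Proof.
move=> r nxy v; have [[_ _ degE] _] := optE; have nFxy := raisable_not_free optE r.
rewrite /count_lhs /count_rhs.
have [->|nvx] := eqVneq v x.
  rewrite nbrs_in_free free_nbrs_sym (negbTE nFxy) (negbTE nxy) adj_sym; lia.
have [->|nvy] := eqVneq v y.
  have := nbrs_in_out y (free_nbrs_irr x).
  rewrite (negbTE (free_nbrs_irr y)) adj_irr [E y x]adj_sym; lia.
have := nbrs_in_out v nFxy; have := degE v; rewrite [E v y]adj_sym.
have [|_] := boolP (v \in free_nbrs M E y); last by lia.
rewrite inE => /andP[_ /negbTE ->]; lia.
Qed.

Lemma sum_count_lhs x y : degree E x < c ->
  \sum_v count_lhs x y v + cross x y
  = c * (#|free_nbrs M E x| + #|free_nbrs M E y| + 2) + degree E y + E x y.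
Proof.
move=> lt_x; have := sum_nbrs_outside y lt_x.
rewrite /count_lhs !big_split /= -!big_distrr /= !sum_eq1.
rewrite (sum_eq_const y (fun=> nat_of_bool (E x y))) -degreeE.
have -> : \sum_v (v \in free_nbrs M E y) = #|free_nbrs M E y|.
  by rewrite -[RHS]mul1n -sum_mem_const; apply: eq_bigr => v _; rewrite mul1n.
lia.
Qed.

Lemma sum_count_rhs x y :
  \sum_v count_rhs x y v = c * #|T| + degree E y + E x y.
Proof.
rewrite /count_rhs !big_split /= sum_nat_const mulnC.
rewrite (sum_eq_const y (fun=> degree E y)).
by rewrite (sum_eq_const x (fun=> nat_of_bool (E y x))) [E y x]adj_sym.
Qed.

Lemma count_free x y : raisable c E x y -> x != y ->
  c * (#|free_nbrs M E x| + #|free_nbrs M E y| + 2) <= cross x y + c * #|T|.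
Proof.
move=> r nxy; have := sum_count_lhs y (raisable_lt r).
have := sum_count_rhs x y.
have : \sum_v count_lhs x y v <= \sum_v count_rhs x y v.
  by apply: leq_sum => v _; apply: count_pointwise.
lia.
Qed.

(** Only one vertex is exceptional now: 1 replaces 2, and [degree E x] no longer cancels. *)
Lemma count_free_twice x : raisable c E x x ->
  c * (#|free_nbrs M E x| + #|free_nbrs M E x| + 1) + degree E x
  <= cross x x + c * #|T|.
Proof.
move=> r; have [[_ _ degE] _] := optE; set P := free_nbrs M E x.
have := sum_nbrs_outside x (raisable_lt r); rewrite -/P.
have : \sum_v (nbrs_in P v * (v \notin P) + E x v + c * (v \in P) + c * (v == x))
    <= \sum_(v : T) c.
  apply: leq_sum => v _; have [->|nvx] := eqVneq v x.
    rewrite nbrs_in_free adj_irr (negbTE (free_nbrs_irr x)); lia.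
  have := nbrs_in_out v (free_nbrs_irr x); have := degE v; rewrite [E v x]adj_sym -/P.
  have [|_] := boolP (v \in P); last by lia.
  rewrite inE => /andP[_ /negbTE ->]; lia.
rewrite !big_split /= -!big_distrr /= sum_eq1 sum_nat_const -degreeE -[#|xpredT|]/#|T|.
have -> : \sum_v (v \in P) = #|P|.
  by rewrite -[RHS]mul1n -sum_mem_const; apply: eq_bigr => v _; rewrite mul1n.
lia.
Qed.

Lemma cross_le x y : raisable c E x y ->
  cross x y <= \sum_(v in free_nbrs M E y) degree L v.
Proof.
move=> r; apply: leq_sum => v Fyv; rewrite degreeE.
apply: (@leq_trans (\sum_(u in free_nbrs M E x) L v u)).
  apply: leq_sum => u Fxu; case Euv: (E u v) => //.
  by rewrite adj_sym (free_free_adj optE r Fxu Fyv Euv).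
by rewrite [X in _ <= X](bigID (mem (free_nbrs M E x))) leq_addr.
Qed.

End Counting.

(** * Triangles and the sparse case *)

Lemma card_free_nbrs (T : finType) (H E : sgraph T) (x : T) :
  (forall u v, E u v -> compl H u v) ->
  #|free_nbrs (compl H) E x| + degree E x + degree H x + 1 = #|T|.
Proof.
move=> sE; rewrite -(sum_eq1 x) !degreeE -!sum1_card big_mkcond -!big_split /=.
apply: eq_bigr => v _; rewrite inE /= /compl_adj eq_sym.
have := sE x v; rewrite /= /compl_adj.
have [->|_] := eqVneq v x; rewrite ?adj_irr //.
by case: (E x v); case: (H x v) => //= /(_ isT).
Qed.

Definition triangle_on (T : finType) (H : sgraph T) (S : {set T}) : Prop :=
  #|S| = 3 /\ forall u v, H u v = [&& u \in S, v \in S & u != v].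

Lemma sum_triangle (T : finType) (S : {set T}) (p : T) : #|S| = 3 ->
  \sum_q [&& p \in S, q \in S & p != q] = 2 * (p \in S).
Proof.
move=> S3; have [pS|_] := boolP (p \in S); last by rewrite big1.
rewrite -(_ : #|S :\ p| = 2) ?muln1; last by move: S3; rewrite (cardsD1 p) pS; lia.
rewrite -sum1_card [RHS]big_mkcond; apply: eq_bigr => q _.
by rewrite !inE eq_sym; case: (q \in S); case: (q == p).
Qed.

Lemma degree_triangle (T : finType) (H : sgraph T) (S : {set T}) (p : T) :
  triangle_on H S -> degree H p = 2 * (p \in S).
Proof.
case=> S3 HE; rewrite -sum_triangle // degreeE.
by apply: eq_bigr => q _; rewrite HE.
Qed.

(** Degrees are at most 2 inside [S] and 0 outside, so a sum of 6 forces equality, first in each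
    degree and then in each adjacency. *)
Lemma triangle_onP (T : finType) (H : sgraph T) (S : {set T}) :
  #|S| = 3 -> (forall u, u \notin S -> degree H u = 0) ->
  6 <= \sum_u degree H u -> triangle_on H S.
Proof.
move=> S3 H0 ge6; split=> // u v.
have HS p q : H p q -> p \in S.
  move=> Hpq; apply: contraT => /H0 d0.
  suff : 0 < degree H p by rewrite d0.
  by apply/degree_gt0P; exists q.
have le1 p q : (H p q : nat) <= [&& p \in S, q \in S & p != q].
  case Hpq: (H p q) => //; rewrite (HS _ _ Hpq) (adj_neq Hpq) andbT /=.
  by rewrite lt0b (HS q p) // adj_sym.
have degH p : degree H p = 2 * (p \in S).
  move: p; apply: eq_sum_pointwise => [p|]; last by rewrite sum_mem_const S3.
  by rewrite -sum_triangle // degreeE; apply: leq_sum => q _; apply: le1.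
have := eq_sum_pointwise (le1 u).
rewrite -degreeE degH sum_triangle // => /(_ (leqnn _) v).
by case: (H u v); case: [&& _, _ & _].
Qed.

(* The required graph here is H and K_n is the ambient one: complements of
   k-regular supergraphs of H are (n-1-k)-factors of the complement of H. *)
Lemma sparse_supergraph (T : finType) (H E : sgraph T) (k : nat) (x y : T) :
  optimal H (compl (empty_graph T)) k E -> raisable k E x y ->
  k.*2 < #|T| -> (forall w, degree H w <= k) -> \sum_w degree H w <= k.+1.*2 ->
  [/\ k = 2, #|T| = 5 & exists S, triangle_on H S].
Proof.
move=> optE r lt_n degH sumH; have [[_ sEM degE] _] := optE.
have card_free w := card_free_nbrs w sEM.
have deg0 w : degree (empty_graph T) w = 0 by rewrite degreeE big1.
have lt_x := raisable_lt r; have lt_y := raisable_lt (raisable_sym r).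
have cross_H := cross_le optE r.
have split_H (A : {set T}) : \sum_w degree H w
    = \sum_(w in A) degree H w + \sum_(w | w \notin A) degree H w.
  exact: bigID.
have [Exy|nxy] := eqVneq x y.
  (* Here [degree E x <= k - 2], and the count exceeds the degree sum [2k + 2] allowed to [H]. *)
  subst y; have := count_free_twice optE r; have := card_free x; have := r x.
  move: cross_H (split_H (free_nbrs (compl (empty_graph T)) E x)).
  rewrite deg0 eqxx; set q := #|_|; set cr := cross _ _ x x.
  by move: (degree E x) q cr => d q cr; nia.
set Q := free_nbrs _ E y in cross_H; move: (split_H Q) => {}split_H.
have := count_free optE r nxy; have := card_free x; have := card_free y.
rewrite !deg0 -/Q; set p := #|free_nbrs _ _ x|.
have nQx : x \notin Q := raisable_not_free optE (raisable_sym r).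
have nQy : y \notin Q := free_nbrs_irr _ _ _.
move=> cardQ cardp cnt.
have lek : k * (#|T| - k.*2 + 2) <= \sum_(w in Q) degree H w.
  apply: leq_trans cross_H.
  by move: (degree E x) (degree E y) (cross _ _ x y) #|Q| lt_x lt_y cardQ cardp cnt; nia.
(* As [#|T| - k.*2 >= 1], the bound [lek] gives [3k <= 2k + 2]. *)
have k_le2 : k <= 2 by nia.
have [k1|k2] : k = 1 \/ k = 2 by lia.
  have : \sum_(w in Q) degree H w <= #|Q|.
    by rewrite -sum1_card; apply: leq_sum => w _; rewrite -k1.
  by move: lek; rewrite k1; lia.
have T5 : #|T| = 5 by move: lek; rewrite k2; lia.
(* For [k = 2] the bound [lek] is tight: [Q], which avoids [x] and [y], carries the whole degree sum
   6 of [H]. *)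
split=> //; exists (~: [set x; y]); apply: triangle_onP.
- by rewrite cardsCs setCK cards2 nxy T5.
- move=> u; rewrite !inE negbK => uxy.
  have nQu : u \notin Q by case/orP: uxy => /eqP ->.
  have : \sum_(w | w \notin Q) degree H w = 0 by move: lek; rewrite k2; lia.
  by move/eqP; rewrite sum_nat_eq0 => /forallP/(_ u); rewrite nQu => /eqP.
- by move: lek; rewrite k2; lia.
Qed.

(** * The dense case *)

Section DenseFactor.
Variables (T : finType) (H : sgraph T) (a N : nat).
Hypotheses (a_gt0 : 0 < a) (card_T : #|T| = a + N).
Hypothesis degH : forall w, degree H w < N.
Hypothesis sumH : \sum_w degree H w <= N.*2.
Hypothesis dense : a = 1 \/ a.+1 < N.
Implicit Types (E : sgraph T) (x y u v w z : T).

Local Notation h := (degree H).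
Local Notation free := (free_nbrs (compl H)).
Local Notation opt := (optimal (empty_graph T) (compl H) a).

Definition deficient_pair E x y : Prop := [/\ opt E, raisable a E x y & x != y].

(** The ends of the alternating paths x - u - v. As the lower graph is empty here, every edge [uv]
    may be exchanged. *)
Definition reach E x : {set T} := [set v | 0 < nbrs_in E (free E x) v].

Lemma deficient_pair_sym E x y : deficient_pair E x y -> deficient_pair E y x.
Proof. by case=> o r n; split=> //; [exact: raisable_sym | rewrite eq_sym]. Qed.

Lemma reachP E x v : v \in reach E x -> exists2 u, u \in free E x & E u v.
Proof.
rewrite inE lt0n sum_nat_eq0 => /forallPn[u]; rewrite negb_imply.
by case/andP=> Fu; rewrite eqb0 negbK; exists u.
Qed.

Lemma mem_reach E x u v : u \in free E x -> E u v -> v \in reach E x.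
Proof. by move=> Fu Euv; rewrite inE /nbrs_in (bigD1 u) //= Euv. Qed.

Lemma reach_irr E x : x \notin reach E x.
Proof. by rewrite inE nbrs_in_free. Qed.

Lemma opt_sub E : opt E -> forall u v, E u v -> compl H u v.
Proof. by case=> [[]]. Qed.

Lemma card_free E x : opt E -> #|free E x| + degree E x + h x + 1 = a + N.
Proof. by move=> /opt_sub/card_free_nbrs ->. Qed.

Lemma deficient_pair_shift E x y v : deficient_pair E x y ->
  v \in reach E x -> v != y -> exists E', deficient_pair E' v y.
Proof.
move=> [o r nxy] /reachP[u Fu Euv] nvy; exists (shift_edge E x u v); split=> //.
  exact: (shift_optimal o r).
exact: shift_raisable r Fu Euv.
Qed.

(** If both units are missing at [x], one of them is shifted away along an alternating path. *)
Lemma raisable_deficient_pair E x y : opt E -> raisable a E x y ->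
  exists E' x' y', deficient_pair E' x' y'.
Proof.
move=> o r; have [Exy|nxy] := eqVneq x y; last by exists E, x, y.
subst y; have lt_x := r x; rewrite eqxx in lt_x.
have /card_gt0P[u Fu] : 0 < #|free E x|.
  by have := card_free x o; have := degH x; lia.
have /degree_gt0P[v Euv] : 0 < degree E u.
  by rewrite (free_nbr_saturated o _ Fu) //; lia.
exists (shift_edge E x u v), v, x; split.
- exact: (shift_optimal o r).
- exact: shift_raisable r Fu Euv.
- by apply: contraTneq Euv => ->; rewrite adj_sym; move: Fu; rewrite inE => /andP[].
Qed.

(** The lower graph is empty, so [cross] vanishes in [count_free]. *)
Lemma deficient_pair_degrees E x y : deficient_pair E x y ->
  a + N <= h x + h y + degree E x + degree E y.
Proof.
case=> o r nxy; have := count_free o r nxy; have := cross_le o r.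
rewrite [X in _ <= X]big1 ?leqn0; last by move=> v _; rewrite degreeE big1.
move=> /eqP ->; rewrite add0n leq_pmul2l // card_T.
by have := card_free x o; have := card_free y o; lia.
Qed.

Lemma deficient_pair_sum E x y : deficient_pair E x y -> N + 2 <= h x + h y + a.
Proof.
move=> d; have := deficient_pair_degrees d; case: d => _ r _.
by have := raisable_lt r; have := raisable_lt (raisable_sym r); lia.
Qed.

(** Every free neighbour of [x] has degree [a]. Of the [a * #|free E x|] incidences, [y] takes fewer
    than [a] and every other reached vertex at most [a]. *)
Lemma card_reach E x y : deficient_pair E x y -> #|free E x| <= #|reach E x :\ y|.
Proof.
case=> o r nxy; have [[_ _ degE] _] := o.
have lt_x := raisable_lt r; have lt_y := raisable_lt (raisable_sym r).
have := sum_degree_free o lt_x; rewrite (bigD1 y) //=.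
have := nbrs_in_sub E (free E x) y.
have : \sum_(v | v != y) nbrs_in E (free E x) v <= a * #|reach E x :\ y|.
  rewrite -sum_mem_const [X in _ <= X](bigD1 y) //= -[X in X <= _]add0n.
  rewrite leq_add // leq_sum // => v nvy; rewrite !inE nvy /=.
  have := leq_trans (nbrs_in_sub E (free E x) v) (degE v).
  by case: (nbrs_in E (free E x) v) => // p; rewrite muln1.
by move=> le1 le2 le3; rewrite -ltnS -(ltn_pmul2l a_gt0) mulnS; lia.
Qed.

(** All [a] neighbours of a single free neighbour of [x] are reached. *)
Lemma card_reach_ge E x y : deficient_pair E x y -> a <= #|reach E x :\ y|.+1.
Proof.
case=> o r nxy; have lt_x := raisable_lt r.
have /card_gt0P[u Fu] : 0 < #|free E x|.
  by have := card_free x o; have := degH x; lia.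
rewrite -(free_nbr_saturated o lt_x Fu) -add1n.
apply: leq_trans (_ : #|reach E x| <= _); last first.
  by rewrite (cardsD1 y) leq_add2r leq_b1.
by apply/subset_leq_card/subsetP => v; rewrite inE => /(mem_reach Fu).
Qed.

(** * Deficient pairs with an end of least degree in [H] *)

Section Minimal.
Variables (E : sgraph T) (x y : T).
Hypothesis dxy : deficient_pair E x y.
Hypothesis miny : forall E' x' y', deficient_pair E' x' y' -> h y <= h y'.

Let min_def E' x' y' : deficient_pair E' x' y' -> h y <= h x'.
Proof. by move/deficient_pair_sym/miny. Qed.

(** Every vertex of [core] is an end of some deficient pair, so its degree in [H] is at least [h y].
    Vertices of [rim] form such a pair together with [y], so [deficient_pair_sum] applies to them as
    well. *)
Let core := x |: (y |: (reach E y :\ x)).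
Let rim := x |: (reach E x :\ y).

Lemma degree_reach v : v \in reach E x -> v != y ->
  h y <= h v /\ N + 2 <= h v + h y + a.
Proof.
move=> Rv nvy; have [E' d'] := deficient_pair_shift dxy Rv nvy.
by split; [exact: min_def d' | exact: deficient_pair_sum d'].
Qed.

Lemma degree_core v : v \in core -> h y <= h v.
Proof.
case/setU1P=> [->|/setU1P[-> //|/setD1P[nvx Rv]]]; first exact: min_def dxy.
have [E' d'] := deficient_pair_shift (deficient_pair_sym dxy) Rv nvx.
exact: min_def d'.
Qed.

Lemma degree_rim v : v \in rim -> h y <= h v /\ N + 2 <= h v + h y + a.
Proof.
case/setU1P=> [->|/setD1P[nvy Rv]]; last exact: degree_reach.
by split; [exact: min_def dxy | exact: deficient_pair_sum dxy].
Qed.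

Lemma card_core : N + 2 <= #|core| + h y.
Proof.
have [o r nxy] := dxy; have lt_y := raisable_lt (raisable_sym r).
have := card_reach (deficient_pair_sym dxy); have := card_free y o.
rewrite /core !cardsU1 !inE eqxx (negbTE nxy) /=.
have := reach_irr E y; rewrite inE => /negbTE ->; rewrite andbF /=; lia.
Qed.

Lemma card_rim : maxn a 2 <= #|rim|.
Proof.
have [o r nxy] := dxy; have lt_x := raisable_lt r.
have := card_reach dxy; have := card_reach_ge dxy; have := card_free x o.
rewrite /rim cardsU1 !inE; have := reach_irr E x; rewrite inE => /negbTE ->.
rewrite andbF /=; have := degH x; lia.
Qed.

(** The coefficient of [rim] is what [N + 2 - a - h y] adds to the [h y] credited to [core];
    truncated subtraction makes it 0 when it adds nothing. *)
Lemma degree_lower_bound v :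
  h y * (v \in core) + (N + 2 - a - (h y).*2) * (v \in rim) <= h v.
Proof.
move: (@degree_rim v) (@degree_core v).
by case: (v \in rim) => [/(_ isT)[r1 r2]|_]; case: (v \in core) => [/(_ isT)|_]; lia.
Qed.

Lemma minimal_params : h y = 2 /\ N = a + 2.
Proof.
have : \sum_v (h y * (v \in core) + (N + 2 - a - (h y).*2) * (v \in rim))
    <= N.*2.
  by apply: leq_trans sumH; apply: leq_sum => v _; apply: degree_lower_bound.
rewrite big_split /= !sum_mem_const.
have := card_core; have := card_rim; have := deficient_pair_sum dxy.
have := degH x; have := degH y; have := min_def dxy.
move: (h y) (h x) #|core| #|rim| => s t p q st sN tN m_le q_ge p_ge le2N.
(* [s(N + 2 - s) - 2N = (s - 2)(N - s)] and [s < N]. *)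
have s2 : s <= 2.
  have : s * (N + 2 - s) <= N.*2.
    apply: leq_trans le2N; apply: leq_trans (leq_addr _ _).
    by rewrite leq_mul2l; lia.
  have [t' EN] : exists t', N = s + t'.+1 by exists (N - s.+1); lia.
  rewrite (_ : N + 2 - s = t' + 3); last lia.
  by rewrite EN => le_s; rewrite -(leq_pmul2r (ltn0Sn t')); lia.
have [m Em] : exists m, N + 2 = m + a by exists (N + 2 - a); lia.
rewrite Em addnK in le2N.
have [s0|[s1|s2']] : s = 0 \/ s = 1 \/ s = 2 by lia.
- have le_mq : m * maxn a 2 <= N.*2.
    by apply: leq_trans (_ : m * q <= _); [rewrite leq_mul2l q_ge orbT | lia].
  case: dense => [a1|a2]; first by rewrite a1 in le_mq Em; lia.
  case: (ltngtP a 2) => [||a_eq]; [lia | move=> a3 | by rewrite a_eq in Em; lia].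
  (* [a(N + 2 - a) - 2N = (a - 2)(N - a)] is positive for [a >= 3]. *)
  have {}le_mq : m * a <= N.*2 by rewrite -(maxn_idPl (ltnW a3)).
  nia.
- have le_mq : p + (m - 2) * maxn a 2 <= N.*2.
    apply: leq_trans (_ : p + (m - 2) * q <= _); last by rewrite s1 in le2N; lia.
    by rewrite leq_add2l leq_mul2l q_ge orbT.
  case: dense => [a1|a2]; first by rewrite a1 in le_mq Em; lia.
  (* The left side exceeds [2N] by at least [(a - 1)(N - a - 1)], positive for [a >= 2]; [a = 1]
     would give [t >= N]. *)
  have {}le_mq : p + (m - 2) * a <= N.*2.
    by apply: leq_trans le_mq; rewrite leq_add2l leq_mul2l leq_maxl orbT.
  nia.
(* The core alone uses up [2N], so the rim coefficient [m - 4] must vanish. *)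
- split=> //; have : m - 4 = 0.
    apply/eqP; rewrite -leqn0 -(leq_pmul2r (_ : 0 < q)); last lia.
    by rewrite s2' in le2N p_ge; lia.
  by case: dense => ?; lia.
Qed.

Definition support : {set T} := [set w | 0 < h w].

(** At least [N] core vertices of degree at least 2 exhaust the degree sum. *)
Lemma degree_supp w : h w = 2 * (w \in core).
Proof.
have [hy EN] := minimal_params; have := card_core; rewrite hy => le_core.
apply/esym/(@eq_sum_pointwise _ (fun w => 2 * (w \in core))) => [v|].
  by case: (boolP (v \in core)) => // /degree_core; rewrite hy muln1.
by rewrite sum_mem_const; apply: leq_trans sumH _; lia.
Qed.

Lemma support_core : support = core.
Proof. by apply/setP => w; rewrite inE degree_supp; case: (_ \in _). Qed.

Lemma minimal_structure :
  [/\ h x = 2, #|support| = N, 2 * N <= \sum_w h w & reach E x \subset support].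
Proof.
have [hy EN] := minimal_params.
have xC : x \in core by rewrite setU11.
have le_core : N <= #|core| by have := card_core; lia.
have eq_sum : \sum_w h w = 2 * #|core|.
  by rewrite -sum_mem_const; apply: eq_bigr => w _; apply: degree_supp.
split; first by rewrite degree_supp xC.
- by rewrite support_core; lia.
- by lia.
apply/subsetP => v Rv; rewrite [v \in support]inE.
have [->|nvy] := eqVneq v y; first by rewrite hy.
by have [] := degree_reach Rv nvy; lia.
Qed.

(* The counting inequality is an equality here, hence an equality termwise. *)
Lemma minimal_tight : 1 < a ->
  (forall z, E y z -> z != x -> z \in free E x /\ z \in support) /\
  (forall v, H y v -> v != x -> v \in reach E x).
Proof.
move=> a_gt1; have [hy EN] := minimal_params; have [o r nxy] := dxy.
have [hx _ _ /subsetP sub_supp] := minimal_structure.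
have lt_x := raisable_lt r; have lt_y := raisable_lt (raisable_sym r).
have := deficient_pair_degrees dxy; rewrite hx hy => degxy.
have tight : forall v, count_lhs (compl H) a E x y v = count_rhs a E x y v.
  apply: eq_sum_pointwise; first exact: (count_pointwise o r nxy).
  have := sum_count_lhs o y lt_x; rewrite sum_count_rhs card_T.
  have -> : cross (compl H) E x y = 0.
    apply/eqP; rewrite -leqn0; apply: leq_trans (cross_le o r) _.
    by rewrite big1 // => v _; rewrite degreeE big1.
  (* [degxy] forces both [degree E x] and [degree E y] to be [a - 1]. *)
  rewrite (_ : #|free E x| = a); last by have := card_free x o; lia.
  rewrite (_ : #|free E y| = a); last by have := card_free y o; lia.
  by rewrite EN; lia.
have nyFx : y \notin free E x := raisable_not_free o r.
have tight_v v : v != x -> v != y -> v \notin free E y ->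
    nbrs_in E (free E x) v + E y v = a.
  move=> /negbTE nvx /negbTE nvy /negbTE nFv; have := tight v.
  by rewrite /count_lhs /count_rhs nvx nvy nFv; lia.
split=> [z Eyz nzx|v Hyv nvx].
  have nzy : z != y by rewrite eq_sym (adj_neq Eyz).
  have nFz : z \notin free E y by rewrite inE Eyz andbF.
  split; last first.
    apply: sub_supp; rewrite inE.
    by have := tight_v z nzx nzy nFz; rewrite Eyz; lia.
  apply: contraT => nFxz.
  (* Equality at [y] allows [y] no neighbour outside [free E x] except [x]; [z] would be another
     one. *)
  have out2 : E x y + 1 <= \sum_(u | u \notin free E x) E y u.
    rewrite (bigD1 x) ?free_nbrs_irr //= (bigD1 z) ?nzx ?nFxz //= Eyz.
    by rewrite [E y x]adj_sym leq_add2l leq_addr.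
  have deg_y : degree E y
      = nbrs_in E (free E x) y + \sum_(u | u \notin free E x) E y u.
    rewrite degreeE (bigID (mem (free E x))) /=; congr (_ + _).
    by apply: eq_bigr => u _; rewrite adj_sym.
  have := tight y; rewrite /count_lhs /count_rhs eqxx.
  rewrite (negbTE (free_nbrs_irr _ _ _)) adj_irr eq_sym (negbTE nxy).
  by move: (nbrs_in _ _ _) deg_y => q; lia.
have nvy : v != y by rewrite eq_sym (adj_neq Hyv).
have nFv : v \notin free E y by rewrite inE /= /compl_adj Hyv andbF.
rewrite inE; have := tight_v v nvx nvy nFv.
suff -> : E y v = false by lia.
by apply/negbTE/negP => /(opt_sub o); rewrite /= /compl_adj Hyv andbF.
Qed.

End Minimal.

(** The free neighbours of [x] are exactly the isolated vertices of [H]. A neighbour [z] of [y]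
    other than [x] would be both free for [x] and in the support, so the only neighbour of [y] is
    [x]. *)
Lemma minimal_adjacent E x y : 1 < a -> deficient_pair E x y ->
  (forall E' x' y', deficient_pair E' x' y' -> h y <= h y') ->
  E x y /\ exists2 v, v \in reach E x & H v y.
Proof.
move=> a_gt1 dxy miny; have [hy EN] := minimal_params dxy miny.
have [hx card_S _ sub_x] := minimal_structure dxy miny.
have dyx := deficient_pair_sym dxy.
have minx : forall E' x' y', deficient_pair E' x' y' -> h x <= h y'.
  by rewrite hx -hy.
have [Ny Hy] := minimal_tight dxy miny a_gt1.
have [Nx _] := minimal_tight dyx minx a_gt1.
have [o r nxy] := dxy; have := deficient_pair_degrees dxy; rewrite hx hy => degxy.
have lt_x := raisable_lt r; have lt_y := raisable_lt (raisable_sym r).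
have free_x : free E x = ~: support.
  apply/esym/eqP; rewrite eqEcard; apply/andP; split; last first.
    by have := card_free x o; rewrite [#|~: _|]cardsCs setCK card_T card_S; lia.
  apply/subsetP => u; rewrite inE inE -leqNgt leqn0 => /eqP hu.
  have nxu : x != u by apply: contra_eq_neq hu => <-; rewrite hx.
  have nH p : H p u = false.
    apply/negbTE/negP; rewrite adj_sym => Hup.
    by suff : 0 < h u by [rewrite hu]; apply/degree_gt0P; exists p.
  rewrite inE /= /compl_adj nxu nH /=; apply/negP => Exu.
  have [Euy|nuy] := eqVneq u y; first by rewrite Euy hy in hu.
  by have [_] := Nx u Exu nuy; rewrite inE hu.
have Exy : E x y.
  have /degree_gt0P[z Eyz] : 0 < degree E y by lia.
  have [<-|nzx] := eqVneq z x; first by rewrite adj_sym.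
  by have [] := Ny z Eyz nzx; rewrite free_x inE => /negbTE ->.
split=> //; have /degree_gt0P[v Hyv] : 0 < h y by rewrite hy.
have nvx : v != x.
  apply: contraTneq (opt_sub o Exy) => <-.
  by rewrite /= /compl_adj adj_sym Hyv andbF.
by exists v; [exact: Hy | rewrite adj_sym].
Qed.

Lemma dense_factor E x y : opt E -> raisable a E x y ->
  [/\ a = 1, N = 3 & exists S, triangle_on H S].
Proof.
move=> o /(raisable_deficient_pair o)[E0 [x0 [y0 d0]]].
pose P (t : sgraph T * T * T) := deficient_pair t.1.1 t.1.2 t.2.
have [|[[E1 x1] y1] d1 min1] := @ex_min_measure _ P (fun t => h t.2).
  by exists (E0, x0, y0).
rewrite /P /= in d1 min1.
have miny E' x' y' (d' : deficient_pair E' x' y') : h y1 <= h y' :=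
  min1 (E', x', y') d'.
have [hy EN] := minimal_params d1 miny.
have [hx card_S sum_ge _] := minimal_structure d1 miny.
have [a1|a_gt1] : a = 1 \/ 1 < a by lia.
  split=> //; first lia; exists support; apply: triangle_onP; first lia.
    by move=> u; rewrite inE -leqNgt leqn0 => /eqP.
  by lia.
(* Moving the deficiency from [x1] to [v] gives another minimal pair, whose ends must be adjacent in
   [E'] although [H v y1] holds. *)
have [_ [v Rv Hvy]] := minimal_adjacent a_gt1 d1 miny.
have [E' d'] := deficient_pair_shift d1 Rv (adj_neq Hvy).
have [Evy _] := minimal_adjacent a_gt1 d' miny.
have [o' _ _] := d'.
by have := opt_sub o' Evy; rewrite /= /compl_adj Hvy andbF.
Qed.

End DenseFactor.

(** * Near-regular subgraphs, and stars *)

Definition near_regular_degrees (T : finType) (a : nat) (F : sgraph T) : Prop :=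
  (forall w, degree F w = a) \/
  exists2 x, degree F x = a.+1 & forall w, w != x -> degree F w = a.

Lemma near_factor_or_triangle (T : finType) (H : sgraph T) (a N : nat) :
  0 < a -> #|T| = a + N -> (forall w, degree H w < N) ->
  \sum_w degree H w <= N.*2 ->
  (exists2 F, spanning_subgraph F (compl H) & near_regular_degrees a F) \/
  [/\ a = 1 \/ a = 2, N = 3 & exists S, triangle_on H S].
Proof.
move=> a_gt0 card_T degH sumH.
have deg0 w : degree (empty_graph T) w = 0 by rewrite degreeE big1.
have [dense|sparse] : (a = 1 \/ a.+1 < N) \/ (1 < a /\ N <= a.+1) by lia.
  have [|w|E optE] := @ex_optimal T (empty_graph T) (compl H) a; rewrite ?deg0 //.
  have [[x [y r]]|nr] := classic (exists x y, raisable a E x y).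
    by right; have [-> -> tri] := dense_factor a_gt0 card_T degH sumH dense optE r;
      split=> //; left.
  left; have [admE _] := optE; have [_ sE _] := admE.
  have [|reg|[x dx reg]] := near_regular admE.
  - by move=> x y r; apply: nr; exists x, y.
  - by exists E => //; left.
  have lt_x : degree E x < a by lia.
  have /card_gt0P[u Fu] : 0 < #|free_nbrs (compl H) E x|.
    by have := card_free_nbrs x sE; have := degH x; lia.
  have := Fu; rewrite inE => /andP[Hxu nExu]; have nxu := adj_neq Hxu.
  (* A free edge fills the missing unit at [x]; its saturated end [u] becomes the exceptional
     vertex. *)
  exists (add_edge E x u).
    by move=> p q /add_edgeP[/sE|[-> ->]|[-> ->]] //; rewrite adj_sym.
  right; exists u => [|w nwu]; rewrite degree_add // ?eqxx ?(negbTE nwu).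
    by rewrite eq_sym (negbTE nxu) (free_nbr_saturated optE lt_x Fu); lia.
  by have [->|nwx] := eqVneq w x; rewrite ?(reg w nwx); lia.
(* On [a + N] vertices the complement of degree [N.-1] is [a], and a missing unit turns into an
   excess. [N <= a.+1] ensures [2(N - 1) < a + N]. *)
have [u v Huv|w|E optE] := @ex_optimal T H (compl (empty_graph T)) N.-1.
- by rewrite /= /compl_adj (adj_neq Huv).
- by have := degH w; lia.
have [[x [y r]]|nr] := classic (exists x y, raisable N.-1 E x y).
  right; have N_gt0 : 0 < N by have := degH x; lia.
  have [|||Nk card5 tri] := sparse_supergraph optE r; last by split=> //; lia.
  - by lia.
  - by move=> w; have := degH w; lia.
  - by rewrite prednK.
left; have [admE _] := optE; have [sH _ _] := admE.
exists (compl E).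
  move=> p q; rewrite /= /compl_adj => /andP[-> /=]; apply: contra; exact: sH.
have degC w := degree_compl E w.
have [|reg|[x dx reg]] := near_regular admE.
- by move=> x y r; apply: nr; exists x, y.
- by left=> w; have := degC w; have := degH w; rewrite reg card_T; lia.
right; exists x => [|w nwx].
  by have := degC x; have := degH x; rewrite card_T; lia.
by have := degC w; have := degH w; rewrite reg // card_T; lia.
Qed.

Lemma star_of_degree (T : finType) (H : sgraph T) (x : T) (N : nat) :
  N <= degree H x -> \sum_w degree H w <= N.*2 ->
  [/\ degree H x = N, \sum_w degree H w = N.*2
    & forall u v, H u v -> u = x \/ v = x].
Proof.
move=> ge_x sumH.
(* [f] gives the degrees in the star of the edges at [x]; its sum already reaches [2N], so there are
   no other edges. *)
pose f u := (u == x) * degree H x + H u x.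
have le_f u : f u <= degree H u.
  rewrite /f; have [->|_] := eqVneq u x; first by rewrite adj_irr; lia.
  by rewrite mul0n add0n degreeE (bigD1 x) //= leq_addr.
have sum_f : \sum_u f u = (degree H x).*2.
  rewrite big_split /= (sum_eq_const x (fun=> degree H x)) -addnn; congr (_ + _).
  by rewrite degreeE; apply: eq_bigr => u _; rewrite adj_sym.
have le_sum : \sum_u f u <= \sum_w degree H w by apply: leq_sum.
have eq_f : forall u, f u = degree H u by apply: eq_sum_pointwise => //; lia.
split; [lia | lia | move=> u v Huv].
have [->|nux] := eqVneq u x; first by left.
have [->|nvx] := eqVneq v x; first by right.
have := eq_f u; rewrite /f (negbTE nux) [degree H u]degreeE (bigD1 x) //= (bigD1 v) //= Huv.
by lia.
Qed.

(** * Isomorphisms with the extremal graphs *)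

Definition color_class (T : finType) (C : eqType) (f : T -> C) (c : C) : {set T} :=
  [set x | f x == c].

(** The k-th vertex of a colour class goes to the k-th vertex of the same colour; [u0] is only the
    default of [nth]. *)
Definition color_transport (T U : finType) (C : eqType) (f : T -> C) (g : U -> C)
    (u0 : U) (x : T) : U :=
  nth u0 (enum (color_class g (f x))) (index x (enum (color_class f (f x)))).

Section ColorTransport.
Variables (T U : finType) (C : eqType) (f : T -> C) (g : U -> C).
Hypothesis eq_card : forall c, #|color_class f c| = #|color_class g c|.

Lemma color_transport_index (x : T) :
  index x (enum (color_class f (f x))) < size (enum (color_class g (f x))).
Proof. by rewrite -cardE -eq_card cardE index_mem mem_enum inE. Qed.

Lemma color_transportE (u0 : U) (x : T) : g (color_transport f g u0 x) = f x.
Proof.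
have := mem_nth u0 (color_transport_index x).
by rewrite mem_enum inE => /eqP.
Qed.

Lemma color_transportK (t0 : T) (u0 : U) :
  cancel (color_transport f g u0) (color_transport g f t0).
Proof.
move=> x; rewrite {1}/color_transport color_transportE.
rewrite index_uniq ?enum_uniq ?color_transport_index // nth_index //.
by rewrite mem_enum inE.
Qed.
End ColorTransport.

Lemma color_bijection (T U : finType) (C : eqType) (f : T -> C) (g : U -> C) :
  (forall c, #|color_class f c| = #|color_class g c|) ->
  exists2 phi : T -> U, bijective phi & forall x, g (phi x) = f x.
Proof.
move=> eq_card; have eq_card' c := esym (eq_card c).
have [t0 _|T0] := pickP (@predT T).
  have /card_gt0P[u0 _] : 0 < #|color_class g (f t0)|.
    by rewrite -eq_card; apply/card_gt0P; exists t0; rewrite inE.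
  exists (color_transport f g u0); last exact: color_transportE.
  by exists (color_transport g f t0); exact: color_transportK.
(* With [T] empty there is no default vertex, and [U] is empty too. *)
have T_False (x : T) : False by have := T0 x.
have U_False (u : U) : False.
  have : 0 < #|color_class f (g u)|.
    by rewrite eq_card; apply/card_gt0P; exists u; rewrite inE.
  by case/card_gt0P=> x _; exact: T_False x.
exists (fun x => False_rect U (T_False x)) => [|x]; last by case: (T_False x).
by exists (fun u => False_rect T (U_False u)) => x;
  [case: (T_False x) | case: (U_False x)].
Qed.

(** Adjacency of distinct vertices depends only on their colours, so any colour-preserving bijection
    will do. *)
Lemma isomorphic_of_coloring (T U : finType) (C : eqType) (G : sgraph T)
    (K : sgraph U) (f : T -> C) (g : U -> C) (tbl : rel C) :
  (forall c, #|color_class f c| = #|color_class g c|) ->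
  (forall x y, G x y = (x != y) && tbl (f x) (f y)) ->
  (forall x y, K x y = (x != y) && tbl (g x) (g y)) -> isomorphic G K.
Proof.
move=> /color_bijection[phi bij_phi phiE] GE KE; exists phi => // x y.
by rewrite KE GE !phiE (bij_eq bij_phi).
Qed.

Lemma card_set_sum (T U : finType) (P : pred (T + U)) :
  #|[set p | P p]| = #|[set x | P (inl x)]| + #|[set y | P (inr y)]|.
Proof.
rewrite -!sum1_card big_mkcond big_sumType [in RHS]big_mkcond.
rewrite [X in _ = _ + X]big_mkcond /=.
by congr (_ + _); apply: eq_bigr => i _; rewrite !inE.
Qed.

Lemma card_set_cst (T : finType) (b : bool) : #|[set x : T | b]| = b * #|T|.
Proof.
by case: b; rewrite ?mul1n ?mul0n; [apply: eq_card => x; rewrite inE | rewrite cards0].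
Qed.

Lemma extremal_isomorphic (T : finType) (G : sgraph T) (a : nat) (x : T) :
  0 < a -> a < #|T| -> degree (compl G) x = #|T| - a ->
  (forall u v, compl G u v -> u = x \/ v = x) ->
  isomorphic G (extremal_graph #|T| a).
Proof.
move=> a_gt0 lt_a deg_x star; set H := compl G in deg_x star.
(* Colour 2 is the centre of the star, 1 its leaves, 0 the rest; only colours 1 and 2 are not
   joined. *)
pose f u := if u == x then 2 else if H x u then 1 else 0.
pose g (p : 'I_(a - 1) + ('I_(#|T| - a) + 'I_1)) :=
  match p with inl _ => 0 | inr (inl _) => 1 | inr (inr _) => 2 end.
pose tbl c d := ~~ ((c == 1) && (d == 2) || (c == 2) && (d == 1)).
apply: (@isomorphic_of_coloring _ _ _ _ _ f g tbl).
- have c2 : #|color_class f 2| = 1.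
    rewrite -[RHS](cards1 x); apply: eq_card => u; rewrite !inE /f.
    by case: (u == x) => //; case: (H x u).
  have c1 : #|color_class f 1| = #|T| - a.
    rewrite -deg_x; apply: eq_card => u; rewrite !inE /f.
    by have [->|_] := eqVneq u x; rewrite ?adj_irr //; case: (H x u).
  have big c : 2 < c -> #|color_class f c| = 0.
    move=> gt2; apply/eqP; rewrite cards_eq0; apply/eqP/setP => u; rewrite !inE /f.
    by case: (u == x); case: (H x u); apply/eqP; lia.
  have c0 : #|color_class f 0| = a - 1.
    have := cardsC (color_class f 0).
    have -> : ~: color_class f 0 = color_class f 1 :|: color_class f 2.
      by apply/setP => u; rewrite !inE /f; case: (u == x); case: (H x u).
    rewrite cardsU c1 c2 (_ : _ :&: _ = set0) ?cards0; first by lia.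
    by apply/setP => u; rewrite !inE /f; case: (u == x); case: (H x u).
  move=> c; rewrite [RHS]card_set_sum [X in _ + X]card_set_sum !card_set_cst !card_ord.
  by case: c => [|[|[|c]]]; rewrite ?c0 ?c1 ?c2 ?big //; lia.
- have HG u v : G u v = (u != v) && ~~ H u v.
    rewrite /H /= /compl_adj negb_and !negbK.
    by have [->|_] := eqVneq u v; rewrite ?adj_irr.
  move=> u v; rewrite HG /tbl /f; congr (_ && ~~ _).
  have [->|nux] := eqVneq u x.
    by have [->|_] := eqVneq v x; rewrite ?adj_irr //; case: (H x v).
  have [->|nvx] := eqVneq v x; first by rewrite adj_sym; case: (H x u).
  have -> : H u v = false.
    by apply/negP => /star[]/eqP; [rewrite (negbTE nux)|rewrite (negbTE nvx)].
  by case: (H x u); case: (H x v).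
- by move=> [u|[u|u]] [v|[v|v]]; rewrite /= /tbl ?andbT.
Qed.

(** [A] is any complete graph on ['I_m], which covers [complete 2] and also the [edgeless 1] of
    [complete_bipartite 1 3]. *)
Lemma join_edgeless_isomorphic (T : finType) (G : sgraph T) (S : {set T})
    (m : nat) (A : sgraph 'I_m) :
  triangle_on (compl G) S -> #|T| = m + 3 -> (forall i j, A i j = (i != j)) ->
  isomorphic G (join A (edgeless 3)).
Proof.
move=> [S3 HE] card_T AE.
pose g (p : 'I_m + 'I_3) := if p is inr _ then true else false.
pose tbl (c d : bool) := ~~ (c && d).
apply: (@isomorphic_of_coloring _ _ _ _ _ (fun u => u \in S) g tbl).
- move=> c; rewrite [RHS]card_set_sum !card_set_cst !card_ord.
  have cT : #|color_class (fun u => u \in S) true| = 3.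
    by rewrite -S3; apply: eq_card => u; rewrite !inE eqb_id.
  have cF : #|color_class (fun u => u \in S) false| = m.
    have := cardsC S; rewrite S3 card_T => cardC.
    have -> : color_class (fun u => u \in S) false = ~: S.
      by apply/setP => u; rewrite !inE eqbF_neg.
    by lia.
  by case: c; rewrite ?cT ?cF; lia.
- move=> u v; have := HE u v; rewrite /= /compl_adj /tbl.
  by have [->|_] := eqVneq u v; rewrite ?adj_irr //= andbT => <-; rewrite negbK.
- move=> [i|i] [j|j]; rewrite /= /tbl ?andbT ?andbF //; exact: AE.
Qed.

(** * Edge counts of the extremal graphs *)

Definition arcs (T : finType) (G : sgraph T) := \sum_x degree G x.

Lemma arcs_isomorphic (T U : finType) (G : sgraph T) (K : sgraph U) :
  isomorphic G K -> arcs G = arcs K.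
Proof.
case=> phi bij_phi phiE; rewrite /arcs [RHS](reindex phi) /=; last exact: onW_bij.
apply: eq_bigr => x _; rewrite !degreeE [RHS](reindex phi) /=; last exact: onW_bij.
by apply: eq_bigr => y _; rewrite phiE.
Qed.

Lemma arcs_sum (T U : finType) (G : sgraph T) (K : sgraph U) (cr : bool) :
  arcs (SGraph (@sum_adj_sym cr T U G K) (@sum_adj_irr cr T U G K))
  = arcs G + arcs K + 2 * (cr * (#|T| * #|U|)).
Proof.
rewrite /arcs big_sumType /=.
under eq_bigr do rewrite degreeE big_sumType /= -degreeE sum_nat_const.
under [X in _ + X]eq_bigr do
  rewrite degreeE big_sumType /= -degreeE sum_nat_const.
by rewrite !big_split /= !sum_nat_const -[#|xpredT|]/#|T| -[#|_|]/#|U|; lia.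
Qed.

Lemma arcs_complete (m : nat) : arcs (complete m) = m * m.-1.
Proof.
rewrite -[in RHS](card_ord m) -sum_nat_const; apply: eq_bigr => x _.
rewrite (_ : degree _ _ = #|~: [set x]|).
  by have := cardsC [set x]; rewrite cards1 card_ord; lia.
by apply: eq_card => y; rewrite !inE eq_sym.
Qed.

Lemma arcs_edgeless (m : nat) : arcs (edgeless m) = 0.
Proof. by rewrite /arcs big1 // => x _; rewrite degreeE big1. Qed.

Lemma double_bin2 (m : nat) : 2 * 'C(m, 2) = m * m.-1.
Proof. by rewrite -mul_bin_diag bin1. Qed.

Lemma arcs_extremal (n a : nat) : 0 < a -> a < n ->
  arcs (extremal_graph n a) = 2 * ('C(n - 1, 2) + (a - 1)).
Proof.
move=> a_gt0 lt_an; rewrite mulnDr double_bin2.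
rewrite /extremal_graph /join arcs_sum /disjoint_union arcs_sum !arcs_complete.
rewrite card_sum !card_ord.
(* Substituting [a = p + 1] and [n = p + q + 2] removes the truncated subtractions. *)
have [p Ep] : exists p, a = p.+1 by exists a.-1; lia.
have [q Eq] : exists q, n = p + q.+2 by exists (n - p.+2); lia.
have -> : n - 1 = p + q.+1 by lia.
have -> : a - 1 = p by lia.
have -> : n - a = q.+1 by lia.
by case: p {Ep Eq} => [|p] /=; rewrite ?addSn /= ?add0n; lia.
Qed.

(** * Factors from triangles and parity, and the characterization *)

Lemma triangle_factor (T : finType) (G : sgraph T) (S : {set T}) (a b : nat) :
  triangle_on (compl G) S -> a = 1 \/ a = 2 -> #|T| = a + 3 -> 3 <= b ->
  exists F, is_factor a b F G.
Proof.
move=> tri a12 card_T b_ge3; have [S3 HE] := tri.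
have degG w : degree G w + 2 * (w \in S) + 1 = a + 3.
  by rewrite -(degree_triangle w tri) degree_compl.
(* For [a = 1] the degrees of [G] are 1 and 3, so [G] itself is a factor. *)
case: a12 => a_eq; first by exists G; split=> // w; have := degG w; lia.
have : #|~: S| = 2 by have := cardsC S; lia.
move/eqP/cards2P=> [p [q [npq SE]]].
have [pS qS] : p \notin S /\ q \notin S.
  by split; rewrite -in_setC SE !inE eqxx ?orbT.
have Gpq : G p q.
  by have := HE p q; rewrite /= /compl_adj npq (negbTE pS) /=; case: (G p q).
(* [p] and [q] drop from degree 4 to 3; the triangle vertices keep degree 2. *)
exists (del_edge G p q); split=> [u v /andP[] //|w].
have := degG w; rewrite (degree_del w Gpq).
have : (w \notin S) = (w == p) || (w == q) by rewrite -in_setC SE !inE.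
have : ~~ ((w == p) && (w == q)).
  by apply: contra npq => /andP[/eqP <-].
by case: (w == p); case: (w == q); case: (w \in S) => //=; lia.
Qed.

(** For [a = b] an exceptional vertex would make the degree sum [#|T| * a + 1], which is odd. *)
Lemma near_regular_factor (T : finType) (G F : sgraph T) (a b : nat) :
  a <= b -> (a = b -> #|T| * a = 0 %[mod 2]) ->
  spanning_subgraph F G -> near_regular_degrees a F -> is_factor a b F G.
Proof.
move=> le_ab par sF [reg|[x dx reg]]; split=> // w; first by rewrite reg; lia.
have lt_ab : a < b.
  rewrite ltn_neqAle le_ab andbT; apply/eqP => /par.
  have := sum_degree F; rewrite (bigD1 x) //= dx.
  under eq_bigr => v nv do rewrite (reg v nv).
  rewrite sum_nat_const (_ : #|_| = #|T|.-1); last first.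
    by rewrite -(cardC1 x); apply: eq_card => v; rewrite !inE.
  have := max_card (pred1 x); rewrite card1 mod0n => T_gt0 sumF.
  have [m Em] : exists m, #|T| = m.+1 by exists #|T|.-1; lia.
  by move: sumF; rewrite Em mulSn /=; lia.
by have [->|nw] := eqVneq w x; rewrite ?dx ?reg //; lia.
Qed.

Theorem theorem1p1 (a b n : nat) (T : finType) (G : sgraph T)
    (a_gt0 : 0 < a) (le_ab : a <= b) (order_G : #|T| = n) (n_ge : a + 1 <= n)
    (parity : a = b -> n * a = 0 %[mod 2])
    (no_factor : ~ exists F : sgraph T, is_factor a b F G) :
  #|edges G| <= 'C(n - 1, 2) + (a - 1) /\
  (#|edges G| = 'C(n - 1, 2) + (a - 1) <->
    [\/ (a * b = 1 \/ a * b = 2) /\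
        (isomorphic G (extremal_graph n a) \/
         isomorphic G (complete_bipartite 1 3)),
        (a = 2 /\ b = 2) /\
        (isomorphic G (extremal_graph n a) \/
         isomorphic G (join (complete 2) (edgeless 3))) |
        3 <= b /\ isomorphic G (extremal_graph n a)]).
Proof.
subst n; set n := #|T| in n_ge parity *; set bnd := 'C(n - 1, 2) + (a - 1).
(* That is, [bnd] edges in [G] mean [n - a] edges in its complement. *)
have twice_bnd : 2 * bnd + (n - a).*2 = n * n.-1.
  rewrite /bnd mulnDr double_bin2.
  have [m Em] : exists m, n = m.+2 by exists n.-2; lia.
  by rewrite Em /=; rewrite Em in n_ge; nia.
have arcsG : arcs G = 2 * #|edges G| := sum_degree G.
have sum_compl : 2 * #|edges G| + \sum_w degree (compl G) w = n * n.-1.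
  rewrite -sum_degree -big_split /= -[n in RHS]/(#|T|) -sum_nat_const.
  by apply: eq_bigr => w _; have := degree_compl G w; rewrite -/n; lia.
(* This yields both the upper bound and the forward direction of the equality case. *)
have ge_bnd : bnd <= #|edges G| -> #|edges G| = bnd /\
    (isomorphic G (extremal_graph n a) \/
     [/\ a = 1 \/ a = 2, n = a + 3, b < 3 & exists S, triangle_on (compl G) S]).
  move=> ge_e.
  have sumH : \sum_w degree (compl G) w <= (n - a).*2 by lia.
  have [/forallP degH|/forallPn[x]] :=
      boolP [forall w, degree (compl G) w < n - a]; last first.
    rewrite -leqNgt => /star_of_degree/(_ sumH)[deg_x sum_eq star].
    split; first lia.
    by left; apply: extremal_isomorphic deg_x star; lia.
  have [|[F sF regF]|[a12 N3 [S tri]]] :=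
      near_factor_or_triangle a_gt0 _ degH sumH; first by rewrite -/n; lia.
    case: no_factor; exists F; apply: near_regular_factor regF => //.
    move=> u v /sF; rewrite /= /compl_adj negb_and !negbK => /andP[nuv].
    by rewrite (negbTE nuv).
  have card_n : n = a + 3 by lia.
  have b_lt3 : b < 3.
    rewrite ltnNge; apply/negP => b_ge3; apply: no_factor.
    exact: triangle_factor tri a12 card_n b_ge3.
  split; last by right; split=> //; exists S.
  have : \sum_w degree (compl G) w = 6; last lia.
  under eq_bigr do rewrite (degree_triangle _ tri).
  by rewrite sum_mem_const (proj1 tri).
split; first by case: (leqP #|edges G| bnd) => // lt_e; have [] := ge_bnd (ltnW lt_e); lia.
split=> [e_eq|].
  have [_ iso] := ge_bnd (eq_leq (esym e_eq)).
  case: iso => [iso|[a12 n_eq b_lt3 [S tri]]].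
    have [b3|[[? ?]|ab]] : 3 <= b \/ (a = 2 /\ b = 2) \/ (a = 1 /\ (b = 1 \/ b = 2)).
      by lia.
    - by constructor 3.
    - by constructor 2; split=> //; left.
    by constructor 1; split; [lia | left].
  case: a12 => a_eq.
    constructor 1; split; first by lia.
    right; apply: (join_edgeless_isomorphic tri); first by rewrite -/n n_eq a_eq.
    by move=> i j; rewrite !ord1.
  constructor 2; split; first by lia.
  by right; apply: (join_edgeless_isomorphic tri); first by rewrite -/n n_eq a_eq.
have of_arcs m : arcs G = 2 * m -> #|edges G| = m by lia.
have ext : isomorphic G (extremal_graph n a) -> #|edges G| = bnd.
  by move/arcs_isomorphic; rewrite arcs_extremal; [apply: of_arcs | lia | lia].
(* The two sporadic graphs fix [n] at 4 and 5, where [bnd] is 3 and 7. *)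
have card_iso (U : finType) (K : sgraph U) : isomorphic G K -> n = #|U|.
  by case=> phi /bij_eq_card.
case=> [[ab [/ext //|iso]]|[[a2 b2] [/ext //|iso]]|[_ /ext //]].
  have a1 : a = 1 by nia.
  have := card_iso _ _ iso; rewrite card_sum !card_ord => n4.
  apply: of_arcs; rewrite (arcs_isomorphic iso) /bnd n4 a1.
  by rewrite /complete_bipartite /join arcs_sum !arcs_edgeless !card_ord.
have := card_iso _ _ iso; rewrite card_sum !card_ord => n5.
apply: of_arcs; rewrite (arcs_isomorphic iso) /bnd n5 a2.
by rewrite /join arcs_sum arcs_complete arcs_edgeless !card_ord.
Qed.
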